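(* Let $W_{\boldsymbol\lambda}$ be a conditionally positive definite (CPD) unilateral weighted shift with weights $\boldsymbol\lambda=\{\lambda_k\}_{k=0}^\infty$, let $(b,c,\nu)$ be its scalar representing triplet and let $(B,C,F)$ be the representing triplet of the operator $W_{\boldsymbol\lambda}$. Suppose that $\vartheta:=\sup\mathrm{supp}(\nu)>1$, $\nu((1,\theta))=0$ for some $\theta\in(1,\vartheta]$ and $$\int_{[0,1)}\frac{1}{(x-1)^2}\,d\nu(x)<\infty.$$ Then $B$ is not compact.
   Context: $\mathbb{Z}_+=\{0,1,2,\dots\}$, $\mathbb{R}_+=[0,\infty)$; scalar measures are positive; $\mathrm{supp}$ denotes closed support. The polynomials $Q_n$ are $Q_0=Q_1=0$ and $Q_n(x)=\sum_{j=0}^{n-2}(n-j-1)x^j$ for $n\geq 2$. A real sequence $\{\gamma_n\}_{n=0}^\infty$ is CPD if $\sum_{i,j=0}^k \gamma_{i+j}\alpha_i\bar\alpha_j\geq 0$ for every finite sequence $\alpha_0,\dots,\alpha_k\in\mathbb{C}$ with $\sum_{j=0}^k\alpha_j=0$. A bounded operator $T$ on a complex Hilbert space $\mathcal{H}$ is CPD if $\{\|T^nh\|^2\}_{n=0}^\infty$ is CPD for every $h\in\mathcal{H}$. A semispectral measure on $\mathbb{R}_+$ is a map $F$ from the Borel $\sigma$-algebra of $\mathbb{R}_+$ to the bounded operators on $\mathcal{H}$ such that $\langle F(\cdot)h,h\rangle$ is a (positive) measure for every $h\in\mathcal{H}$. It is known that $T$ is CPD if and only if there are bounded operators $B=B^*$,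 $C\geq0$ and a compactly supported semispectral measure $F$ on $\mathbb{R}_+$ with $F(\{1\})=0$ such that $T^{*n}T^n=I+nB+n^2C+\int_{\mathbb{R}_+}Q_n(x)\,F(dx)$ for all $n\in\mathbb{Z}_+$; the triplet $(B,C,F)$ is then unique and is called the representing triplet of $T$. For a bounded sequence $\boldsymbol\lambda$ of positive reals, $W_{\boldsymbol\lambda}$ is the bounded operator on $\ell^2$ with $W_{\boldsymbol\lambda}e_n=\lambda_ne_{n+1}$ ($\{e_n\}$ the standard orthonormal basis); $\hat\lambda_0=1$ and $\hat\lambda_n=\lambda_0^2\cdots\lambda_{n-1}^2$ for $n\geq1$. If $W_{\boldsymbol\lambda}$ is CPD, its scalar representing triplet is the unique $(b,c,\nu)$ with $b\in\mathbb{R}$, $c\in\mathbb{R}_+$, $\nu$ a compactly supported finite Borel measure on $\mathbb{R}_+$ with $\nu(\{1\})=0$ and $\hat\lambda_n=1+bn+cn^2+\int_{\mathbb{R}_+}Q_n\,d\nu$ for all $n\in\mathbb{Z}_+$. *)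

(* Defs.v *)
From HB Require Import structures.
From mathcomp Require Import all_boot all_order all_algebra.
From mathcomp Require Import sesquilinear.
From mathcomp Require Import all_classical all_reals all_analysis.
From mathcomp Require Import complex ring lra.

Set Implicit Arguments.
Unset Strict Implicit.
Unset Printing Implicit Defensive.

Import Order.TTheory GRing.Theory Num.Theory.
Import numFieldNormedType.Exports.
Import Normc.

Local Open Scope classical_set_scope.
Local Open Scope ring_scope.
Local Open Scope complex_scope.

HB.mixin Record NormedModule_isHilbert (R : realType) H
    & CompleteNormedModule R[i] H := {
  inner : {dot H for @Num.conj R[i]};
  inner_normE : forall x : H, inner x x = `|x| ^+ 2 }.

#[short(type="hilbertType")]
HB.structure Definition Hilbert (R : realType) :=
  { H of CompleteNormedModule R[i] H & NormedModule_isHilbert R H }.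

Section operators.
Context {R : realType} {H : hilbertType R}.
Implicit Types (S T : {linear H -> H}).

Definition bounded_operator T := bounded_near T (nbhs (0 : H)).

Definition compact_operator T := precompact (T @` [set h : H | `|h| <= 1]).

Definition adjoint T S := forall x y : H, inner (T x) y = inner x (S y).

(* The order of R[i] makes [0 <= z] entail that z is real. *)
Definition positive_operator T := forall h : H, 0 <= inner (T h) h.

Definition cpd_sequence (g : nat -> R) := forall k (a : 'I_k.+1 -> R[i]),
  \sum_(j < k.+1) a j = 0 ->
  0 <= \sum_(i < k.+1) \sum_(j < k.+1) (g (i + j)%N)%:C * a i * (a j)^*.

(* Norms on H take their (real) values in R[i]. *)
Definition cpd_operator T := bounded_operator T /\
  forall h : H, cpd_sequence (fun n => complex.Re `|iter n T h| ^+ 2).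

End operators.

Definition Qpoly (R : realType) (n : nat) : {poly R} :=
  \poly_(j < n.-1) (n - j - 1)%:R.

(* Borel measures on [0, +oo[ are encoded as Borel measures on R that vanish
   on ]-oo, 0[, and likewise for semispectral measures. *)

Section semispectral.
Context {R : realType} {H : hilbertType R}.
Implicit Types (F : set R -> {linear H -> H}) (T : {linear H -> H}).

Definition form_measure F (h : H) (mu : {finite_measure set R -> \bar R}) :=
  forall A : set R, measurable A -> inner (F A h) h = (fine (mu A))%:C.

Definition semispectral_measure F :=
  [/\ forall A : set R, measurable A -> bounded_operator (F A),
      forall h : H, exists mu, form_measure F h mu &
      forall h : H, F `]-oo, 0[%classic h = 0].

Definition semispectral_support F : set R :=
  [set x | forall U : set R, open U -> U x -> exists h : H, F U h != 0].

(* T is the weak integral of f: the quadratic forms of an operator on a complex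
   Hilbert space determine it, so there is at most one such T. *)
Definition is_operator_integral (f : R -> R) F T := bounded_operator T /\
  forall (h : H) mu, form_measure F h mu ->
    inner (T h) h = (\int[mu]_(x in `[0%R, +oo[) f x)%:C.

Definition representing_triplet T (B C : {linear H -> H}) F :=
  [/\ bounded_operator B /\ adjoint B B,
      bounded_operator C /\ positive_operator C,
      semispectral_measure F /\ compact (semispectral_support F),
      forall h : H, F [set 1] h = 0 &
      exists2 Tstar : {linear H -> H},
        bounded_operator Tstar /\ adjoint T Tstar &
        forall n, exists2 I : {linear H -> H},
          is_operator_integral (fun x => (Qpoly R n).[x]) F I &
          forall h : H, iter n Tstar (iter n T h) =
            h + n%:R *: B h + (n ^ 2)%:R *: C h + I h].

End semispectral.

Definition measure_support (R : realType)
    (nu : {finite_measure set R -> \bar R}) : set R :=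
  [set x | forall U : set R, open U -> U x -> (0 < nu U)%E].

Section complex_series.
Context {R : realType}.
Implicit Types u v : nat -> R[i].

Definition abs_summable u := cvgn (series (fun n => normc (u n))).

(* The library has no completeness instance on R[i]; the sum of an absolutely
   convergent complex series is therefore taken componentwise. *)
Definition csum u : R[i] :=
  limn (series (fun n => complex.Re (u n)))
  +i* limn (series (fun n => complex.Im (u n))).

Lemma normc_sqr (z : R[i]) :
  normc z ^+ 2 = complex.Re z ^+ 2 + complex.Im z ^+ 2.
Proof. by case: z => a b /=; rewrite sqr_sqrtr// addr_ge0// sqr_ge0. Qed.

Lemma normc_ge0 (z : R[i]) : 0 <= normc z.
Proof. by case: z => a b; exact: sqrtr_ge0. Qed.

Lemma normr_Re_le (z : R[i]) : `|complex.Re z| <= normc z.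
Proof. by rewrite -lecR; exact: normc_ge_Re. Qed.

Lemma normr_Im_le (z : R[i]) : `|complex.Im z| <= normc z.
Proof.
rewrite -(@ler_pXn2r _ 2) ?nnegrE ?normc_ge0//.
by rewrite normc_sqr real_normK ?num_real// lerDr sqr_ge0.
Qed.

Lemma series_dominated (a b : nat -> R) : (forall n, `|a n| <= b n) ->
  cvgn (series b) -> cvgn (series a).
Proof.
move=> ab cb; apply: normed_cvg; apply: (series_le_cvg _ _ ab cb) => n //=.
exact: le_trans (ab n).
Qed.

Lemma abs_summable_Re u :
  abs_summable u -> cvgn (series (fun n => complex.Re (u n))).
Proof. by apply: series_dominated => n; exact: normr_Re_le. Qed.

Lemma abs_summable_Im u :
  abs_summable u -> cvgn (series (fun n => complex.Im (u n))).
Proof. by apply: series_dominated => n; exact: normr_Im_le. Qed.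

Let ReD (z w : R[i]) : complex.Re (z + w) = complex.Re z + complex.Re w.
Proof. by case: z w => [? ?] []. Qed.

Let ImD (z w : R[i]) : complex.Im (z + w) = complex.Im z + complex.Im w.
Proof. by case: z w => [? ?] []. Qed.

Lemma csumD u v : abs_summable u -> abs_summable v ->
  csum (fun n => u n + v n) = csum u + csum v.
Proof.
move=> su sv; rewrite /csum.
have -> : (fun n => complex.Re (u n + v n)) =
    (fun n => complex.Re (u n)) + (fun n => complex.Re (v n)).
  by apply/funext => n; exact: ReD.
have -> : (fun n => complex.Im (u n + v n)) =
    (fun n => complex.Im (u n)) + (fun n => complex.Im (v n)).
  by apply/funext => n; exact: ImD.
by rewrite (lim_seriesD (abs_summable_Re su) (abs_summable_Re sv))
  (lim_seriesD (abs_summable_Im su) (abs_summable_Im sv)).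
Qed.

Let ReM (z w : R[i]) : complex.Re (z * w) =
  complex.Re z * complex.Re w - complex.Im z * complex.Im w.
Proof. by case: z w => [? ?] []. Qed.

Let ImM (z w : R[i]) : complex.Im (z * w) =
  complex.Re z * complex.Im w + complex.Im z * complex.Re w.
Proof. by case: z w => [? ?] []. Qed.

Lemma csumZ a u : abs_summable u -> csum (fun n => a * u n) = a * csum u.
Proof.
move=> su.
have cr := abs_summable_Re su; have ci := abs_summable_Im su.
have zr (k : R) (w : nat -> R) : cvgn (series w) -> cvgn (series (k *: w)).
  exact: is_cvg_seriesZ.
rewrite /csum.
have -> : (fun n => complex.Re (a * u n)) =
    complex.Re a *: (fun n => complex.Re (u n))
      - complex.Im a *: (fun n => complex.Im (u n)).
  by apply/funext => n; exact: ReM.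
have -> : (fun n => complex.Im (a * u n)) =
    complex.Re a *: (fun n => complex.Im (u n))
      + complex.Im a *: (fun n => complex.Re (u n)).
  by apply/funext => n; exact: ImM.
rewrite (lim_seriesB (zr _ _ cr) (zr _ _ ci)).
rewrite (lim_seriesD (zr _ _ ci) (zr _ _ cr)).
rewrite !(lim_seriesZ _ cr) !(lim_seriesZ _ ci).
by case: (a).
Qed.

Lemma csum_conj u : abs_summable u -> csum (fun n => (u n)^*) = (csum u)^*.
Proof.
move=> su; rewrite /csum /=; congr (_ +i* _).
  by congr (limn (series _)); apply/funext => n; case: (u n).
rewrite -lim_seriesN; last exact: abs_summable_Im.
congr (limn (series _)); apply/funext => n.
by rewrite -[RHS]/(- complex.Im (u n)); case: (u n).
Qed.

Lemma normc_conj (z : R[i]) : normc z^* = normc z.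
Proof. by case: z => a b /=; rewrite sqrrN. Qed.

Lemma abs_summableM u v : cvgn (series (fun n => normc (u n) ^+ 2)) ->
    cvgn (series (fun n => normc (v n) ^+ 2)) ->
  abs_summable (fun n => u n * (v n)^*).
Proof.
move=> su sv; have := is_cvg_seriesD su sv; apply: series_dominated => n.
rewrite normcM normc_conj ger0_norm ?mulr_ge0 ?normc_ge0// -[leRHS]/(_ + _).
have := sqr_ge0 (normc (u n) - normc (v n)); have := sqr_ge0 (normc (u n) + normc (v n)).
lra.
Qed.

End complex_series.


Section dot_norm.
Context (C : numClosedFieldType) (U : lmodType C) (form : {dot U for @Num.conj C}).

Lemma dot_CauchySchwarz u v : `|form u v| ^+ 2 <= form u u * form v v.
Proof.
have [->|v0] := eqVneq v 0; first by
  rewrite linear0r normr0 expr0n mulr_ge0// dnorm_ge0.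
have v0' : form v v != 0 by rewrite dnorm_eq0.
pose a := form u v / form v v.
have ou : form (u - a *: v) v = 0.
  by rewrite linearBl/= linearZl_LR/= divfK// subrr.
rewrite -[in leRHS](subrK (a *: v) u) hnormDd/=; last first.
  by rewrite linearZr_LR/= ou mulr0.
rewrite mulrDl dnormZ -mulrA -expr2.
rewrite -[form v v ^+ 2](ger0_norm (exprn_ge0 _ (dnorm_ge0 form v))) normrX.
by rewrite -exprMn -normrM divfK// lerDr mulr_ge0// dnorm_ge0.
Qed.

Lemma dot_triangle u v :
  sqrtC (form (u + v) (u + v)) <= sqrtC (form u u) + sqrtC (form v v).
Proof.
have nn w : 0 <= sqrtC (form w w) by rewrite sqrtC_ge0 dnorm_ge0.
rewrite -(@ler_pXn2r _ 2) ?nnegrE ?addr_ge0//.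
rewrite sqrrD !sqrtCK dnormD /= [leRHS]addrAC lerD2l.
have -> : form u v + (form u v)^* = 'Re (form u v) *+ 2.
  by rewrite ReE -mulr_natr divfK// pnatr_eq0.
rewrite lerMn2r/=.
have [+ _] := leif_Re_Creal (form u v); move/le_trans; apply.
rewrite -(@ler_pXn2r _ 2) ?nnegrE ?mulr_ge0// exprMn !sqrtCK.
exact: dot_CauchySchwarz.
Qed.

End dot_norm.

Section ell2.
Variable R : realType.

#[local] Arguments normc : simpl never.

(* R[i]^o is R[i] as a module over itself; R[i] alone is an R-module. *)
Definition ell2_pred : {pred nat -> R[i]^o} :=
  mem [set f : nat -> R[i] | cvgn (series (fun n => normc (f n) ^+ 2))].

Record ell2 := Ell2 {ell2_fun :> nat -> R[i]^o; _ : ell2_fun \in ell2_pred}.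

HB.instance Definition _ := [isSub for ell2_fun].
HB.instance Definition _ := [Choice of ell2 by <:].

Lemma ell2_submod_closed : submod_closed ell2_pred.
Proof.
split=> [|a f g]; rewrite !inE/=.
  rewrite (_ : series _ = cst 0); first exact: is_cvg_cst.
  by apply/funext => n; rewrite /series/= big1// => k _;
  rewrite -[normc _]/(normc (0 : R[i])) normc0 expr0n.
move=> cf cg.
have cvgZ (k : R) (w : nat -> R) : cvgn (series w) -> cvgn (series (k *: w)).
  exact: is_cvg_seriesZ.
have := is_cvg_seriesD (cvgZ (2 * normc a ^+ 2) _ cf) (cvgZ 2 _ cg).
apply: series_dominated => n; rewrite ger0_norm ?sqr_ge0//.
rewrite -[leRHS]/(2 * normc a ^+ 2 * normc (f n) ^+ 2 + 2 * normc (g n) ^+ 2).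
rewrite -mulrA -exprMn -normcM.
have := le_normcD (a * f n : Rcomplex R) (g n).
rewrite -[(a *: f + g) n]/(a * f n + g n).
move: (normc_ge0 (a * f n + g n)).
move: (normc _) (normc (g n)) (normc _) => x y z z0 zxy.
have : z ^+ 2 <= (x + y) ^+ 2 by rewrite ler_pXn2r ?nnegrE// (le_trans z0).
have := sqr_ge0 (x - y); lra.
Qed.

HB.instance Definition _ :=
  GRing.isSubmodClosed.Build _ _ ell2_pred ell2_submod_closed.
HB.instance Definition _ := [SubChoice_isSubLmodule of ell2 by <:].

Lemma ell2P (f : ell2) : cvgn (series (fun n => normc (f n) ^+ 2)).
Proof. by have := valP f; rewrite inE. Qed.

Lemma ell2_summable (f g : ell2) : abs_summable (fun n => f n * (g n)^*).
Proof. exact: abs_summableM (@ell2P f) (@ell2P g). Qed.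

Definition ell2_inner (f g : ell2) : R[i] := csum (fun n => f n * (g n)^*).

Lemma ell2_innerC f g : ell2_inner f g = (ell2_inner g f)^*.
Proof.
rewrite /ell2_inner -(csum_conj (@ell2_summable g f)).
congr csum; apply/funext => n.
by rewrite rmorphM/= conjcK mulrC.
Qed.

Lemma ell2_inner_linear g : linear_for *%R (ell2_inner^~ g).
Proof.
move=> a f1 f2.
have sa : abs_summable (fun n => a * (f1 n * (g n)^*)).
  rewrite (_ : (fun _ => _) = (fun n => (a *: f1) n * (g n)^*)).
    exact: ell2_summable.
  by apply/funext => n; rewrite mulrA.
rewrite /ell2_inner -(csumZ a (@ell2_summable f1 g)).
rewrite -(csumD sa (@ell2_summable f2 g)).
congr csum; apply/funext => n.
by rewrite -[(a *: f1 + f2) n]/(a * f1 n + f2 n) mulrDl mulrA.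
Qed.

Lemma ell2_innerE f :
  ell2_inner f f = (limn (series (fun n => normc (f n) ^+ 2)))%:C.
Proof.
rewrite /ell2_inner /csum; congr (_ +i* _).
  congr (limn (series _)); apply/funext => n.
  by rewrite normc_sqr; case: (f n) => x y /=; ring.
rewrite (_ : series _ = cst 0) ?lim_cst//.
apply/funext => n; rewrite /series/= big1// => k _.
by case: (f k) => x y /=; ring.
Qed.

Lemma ell2_inner_gt0 f : f != 0 -> 0 < ell2_inner f f.
Proof.
move=> f0; rewrite ell2_innerE ltcR.
have nd : nondecreasing_seq (series (fun n => normc (f n) ^+ 2)).
  by apply: nondecreasing_series => n _ _; exact: sqr_ge0.
rewrite lt_neqAle; apply/andP; split; last first.
  by apply: le_trans (nondecreasing_cvgn_le nd (@ell2P f) 0%N); rewrite /series/= big_geq.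
apply/eqP => l0; move/eqP: f0; apply; apply/val_inj/funext => n /=.
apply: (@eq0_normc R); apply/eqP; rewrite -sqrf_eq0 eq_le sqr_ge0 andbT.
have := nondecreasing_cvgn_le nd (@ell2P f) n.+1; rewrite -l0; apply: le_trans.
rewrite /series/= big_nat_recr//= lerDr sumr_ge0// => k _; exact: sqr_ge0.
Qed.

Lemma ell2_inner_bilinear :
  bilinear_for ( *%R : R[i] -> R[i] -> R[i]) (Num.conj \; *%R) ell2_inner.
Proof.
split=> [g|f]; first exact: ell2_inner_linear.
move=> a g1 g2; rewrite (ell2_innerC f g1) (ell2_innerC f g2).
by rewrite ell2_innerC ell2_inner_linear rmorphD rmorphM.
Qed.

HB.instance Definition _ := bilinear_isBilinear.Build R[i] ell2 ell2 R[i]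
  *%R (Num.conj \; *%R) ell2_inner ell2_inner_bilinear.

Lemma ell2_inner_herm f g :
  ell2_inner f g = (-1) ^+ false * Num.conj (ell2_inner g f).
Proof. by rewrite mul1r; exact: ell2_innerC. Qed.

HB.instance Definition _ := isHermitianSesquilinear.Build R[i] ell2 false
  Num.conj ell2_inner ell2_inner_herm.
HB.instance Definition _ := isDotProduct.Build R[i] ell2 ell2_inner ell2_inner_gt0.

Definition ell2_norm (f : ell2) : R[i] := sqrtC (ell2_inner f f).

Lemma ell2_normZ (a : R[i]) f : ell2_norm (a *: f) = `|a| * ell2_norm f.
Proof.
have f0 : 0 <= ell2_inner f f := dnorm_ge0 ell2_inner f.
by rewrite /ell2_norm dnormZ sqrtCM ?nnegrE ?exprn_ge0 ?normr_ge0// sqrCK.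
Qed.

Lemma ell2_norm_eq0 f : ell2_norm f = 0 -> f = 0.
Proof. move/eqP; rewrite sqrtC_eq0 => f0; apply/eqP.
by rewrite -(dnorm_eq0 ell2_inner). Qed.

HB.instance Definition _ := Lmodule_isNormed.Build R[i] ell2
  (dot_triangle ell2_inner) ell2_normZ ell2_norm_eq0.

Lemma ell2_normE (f : ell2) :
  `|f| ^+ 2 = (limn (series (fun n => normc (f n) ^+ 2)))%:C.
Proof. by rewrite -ell2_innerE -[`|f|]/(ell2_norm f) sqrtCK. Qed.

Lemma ell2_partial_le (f : ell2) (e : R) N : 0 <= e -> `|f| <= e%:C ->
  series (fun n => normc (f n) ^+ 2) N <= e ^+ 2.
Proof.
move=> e0 fe.
have nd : nondecreasing_seq (series (fun n => normc (f n) ^+ 2)).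
  by apply: nondecreasing_series => n _ _; exact: sqr_ge0.
apply: le_trans (nondecreasing_cvgn_le nd (@ell2P f) N) _.
by rewrite -lecR -ell2_normE rmorphXn ler_pXn2r ?nnegrE ?lecR.
Qed.

Lemma ell2_of_partial (u : nat -> R[i]) (e : R) : 0 <= e ->
    (forall N, series (fun n => normc (u n) ^+ 2) N <= e ^+ 2) ->
  exists2 f : ell2, f =1 u & `|f| <= e%:C.
Proof.
move=> e0 ue.
have nd : nondecreasing_seq (series (fun n => normc (u n) ^+ 2)).
  by apply: nondecreasing_series => n _ _; exact: sqr_ge0.
have cu : cvgn (series (fun n => normc (u n) ^+ 2)).
  by apply: nondecreasing_is_cvgn => //; exists (e ^+ 2) => _ [N _ <-].
have uP : (u : nat -> R[i]^o) \in ell2_pred by rewrite inE.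
exists (Ell2 uP) => //.
rewrite -(@ler_pXn2r _ 2) ?nnegrE ?lecR// ell2_normE -rmorphXn lecR.
by apply: limr_le => //; exact: nearW.
Qed.

Lemma ell2_coord_le (f : ell2) n : (normc (f n))%:C <= `|f|.
Proof.
have f0 : `|f| \is Num.real by exact: normr_real.
have e0 : 0 <= complex.Re `|f| by rewrite -lecR (RRe_real f0); exact: normr_ge0.
have := @ell2_partial_le f _ n.+1 e0.
rewrite (RRe_real f0) lexx => /(_ isT) fn.
rewrite -(RRe_real f0) lecR -(@ler_pXn2r _ 2) ?nnegrE ?normc_ge0//.
apply: le_trans fn; rewrite /series/= big_nat_recr//= lerDr sumr_ge0// => k _.
exact: sqr_ge0.
Qed.

Lemma ell2_complete (F : set_system ell2) :
  ProperFilter F -> cauchy F -> cvg F.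
Proof.
move=> FF /cauchyP Fc.
have Fball (e : R) : 0 < e -> exists f, F (ball f e%:C).
  by move=> e0; apply: Fc; rewrite ltcR.
have coordcvg (p : R[i] -> R) : (forall z w, p (z - w) = p z - p w) ->
    (forall z, `|p z| <= normc z) ->
    forall n, cvg ((fun f : ell2 => p (f n)) @ F).
  move=> pB pn n; apply/cauchy_cvgP/cauchyP => e e0.
  have [f Ff] := Fball e e0; exists (p (f n)).
  suff : F [set g : ell2 | ball (p (f n)) e (p (g n))] by [].
  apply: filterS Ff => g; rewrite -!ball_normE/= -pB => fg.
  rewrite (le_lt_trans (pn _))// -ltcR (le_lt_trans _ fg)//.
  exact: (ell2_coord_le (f - g) n).
have cRe := coordcvg (@complex.Re R).
have cIm := coordcvg (@complex.Im R).
have {}cRe : forall n, cvg ((fun f : ell2 => complex.Re (f n)) @ F).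
  by apply: cRe => [[? ?] []|z]//; exact: normr_Re_le.
have {}cIm : forall n, cvg ((fun f : ell2 => complex.Im (f n)) @ F).
  by apply: cIm => [[? ?] []|z]//; exact: normr_Im_le.
pose u n : R[i] := lim ((fun f : ell2 => complex.Re (f n)) @ F)
                     +i* lim ((fun f : ell2 => complex.Im (f n)) @ F).
have termcvg (g : ell2) k :
    (fun h : ell2 => normc (h k - g k) ^+ 2) @ F --> normc (u k - g k) ^+ 2.
  under eq_fun do rewrite normc_sqr.
  rewrite normc_sqr; apply: cvgD; rewrite expr2;
    under eq_fun do rewrite expr2.
  - rewrite (_ : (fun h : ell2 => _) =
        (fun h : ell2 => (complex.Re (h k) - complex.Re (g k)) *
                         (complex.Re (h k) - complex.Re (g k)))); last first.
      by apply/funext => h; case: (h k) (g k) => [? ?] [].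
    rewrite (_ : complex.Re (u k - g k) =
        lim ((fun f : ell2 => complex.Re (f k)) @ F) - complex.Re (g k)).
      by apply: cvgM; apply: cvgB; do ?[exact: cRe|exact: cvg_cst].
    by rewrite /u; case: (g k).
  - rewrite (_ : (fun h : ell2 => _) =
        (fun h : ell2 => (complex.Im (h k) - complex.Im (g k)) *
                         (complex.Im (h k) - complex.Im (g k)))); last first.
      by apply/funext => h; case: (h k) (g k) => [? ?] [].
    rewrite (_ : complex.Im (u k - g k) =
        lim ((fun f : ell2 => complex.Im (f k)) @ F) - complex.Im (g k)).
      by apply: cvgM; apply: cvgB; do ?[exact: cIm|exact: cvg_cst].
    by rewrite /u; case: (g k).
have sumcvg (g : ell2) N :
    (fun h : ell2 => series (fun k => normc (h k - g k) ^+ 2) N) @ F -->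
    series (fun k => normc (u k - g k) ^+ 2) N.
  elim: N => [|N IH].
    rewrite /series/= big_geq//; under eq_fun do rewrite big_geq//.
    exact: cvg_cst.
  rewrite seriesSr; under eq_fun do rewrite seriesSr.
  by apply: cvgD; [exact: IH|exact: termcvg].
have bd (e : R) (f g : ell2) : 0 < e -> F (ball f e%:C) -> ball f e%:C g ->
    forall N, series (fun k => normc (u k - g k) ^+ 2) N <= (e + e) ^+ 2.
  move=> e0 Fe fg N; apply: (cvgr_to_le (sumcvg g N)).
  apply: filterS Fe => h fh.
  apply: (@ell2_partial_le (h - g)); first by rewrite addr_ge0 ?ltW.
  rewrite (_ : h - g = (f - g) - (f - h)); last first.
    by rewrite opprB [RHS]addrC subrKA.
  move: fg fh; rewrite -!ball_normE/= => fg fh.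
  by rewrite rmorphD (le_trans (ler_normB _ _))// lerD// ltW.
have appr (e : R) (f : ell2) : 0 < e -> F (ball f e%:C) ->
    forall g, ball f e%:C g ->
    exists2 v : ell2, v =1 u & `|v - g| <= (e + e)%:C.
  move=> e0 Fe g fg.
  have ee : 0 <= e + e by rewrite addr_ge0 ?ltW.
  have [w wu wn] := ell2_of_partial ee (bd e f g e0 Fe fg).
  exists (w + g); last by rewrite addrK.
  by move=> k; rewrite -[(w + g) k]/(w k + g k) wu subrK.
have [f1 Ff1] := Fball 1 ltr01.
have [|v vu _] := appr 1 f1 ltr01 Ff1 f1; first exact: ballxx.
apply/cvg_ex; exists v; apply/cvgrPdist_le => eps eps0.
have epsE : eps = (complex.Re eps)%:C by rewrite RRe_real// gtr0_real.
have e0 : 0 < complex.Re eps / 2.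
  by rewrite divr_gt0// -ltcR -epsE.
have [f Ff] := Fball _ e0; apply: filterS (Ff) => g fg.
have [w wu] := appr _ f e0 Ff g fg.
rewrite -splitr -epsE (_ : w = v)//.
by apply/val_inj/funext => k; exact: etrans (wu k) (esym (vu k)).
Qed.

HB.instance Definition _ := Uniform_isComplete.Build ell2 ell2_complete.


Lemma ell2_inner_normE (f : ell2) : ell2_inner f f = `|f| ^+ 2.
Proof. by rewrite ell2_normE ell2_innerE. Qed.

HB.instance Definition _ :=
  NormedModule_isHilbert.Build R ell2 ell2_inner_normE.

Lemma ell2_unit_subproof n : (fun k => (k == n)%:R) \in ell2_pred.
Proof.
rewrite inE /=.
have sE N : series (fun k => normc ((k == n)%:R : R[i]) ^+ 2) N = (n < N)%:R :> R.
  elim: N => [|N IH]; first by rewrite /series/= big_geq.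
  rewrite seriesSr IH [in RHS]ltnS [in RHS]leq_eqVlt eq_sym.
  case: eqVneq => [->|_] /=; first by rewrite ltnn normc1 expr1n add0r.
  by rewrite normc0 expr0n addr0.
apply: nondecreasing_is_cvgn.
  by apply: nondecreasing_series => k _ _; exact: sqr_ge0.
by exists 1 => _ [N _ <-]; rewrite sE; case: (n < N)%N.
Qed.

Definition ell2_unit n : ell2 := Ell2 (ell2_unit_subproof n).

End ell2.

Section weighted_shift.
Context {R : realType}.
Implicit Type lam : nat -> R.

Definition is_weighted_shift lam (W : {linear ell2 R -> ell2 R}) :=
  bounded_operator W /\
  forall n, W (ell2_unit R n) = (lam n)%:C *: ell2_unit R n.+1.

Definition weight_hat lam (n : nat) : R := \prod_(i < n) lam i ^+ 2.

Definition scalar_representing_triplet lam (b c : R)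
    (nu : {finite_measure set R -> \bar R}) :=
  [/\ 0 <= c,
      nu `]-oo, 0[%classic = 0%E /\ compact (measure_support nu),
      nu [set 1] = 0%E &
      forall n, weight_hat lam n = 1 + b * n%:R + c * (n ^ 2)%:R
                  + \int[nu]_(x in `[0%R, +oo[) (Qpoly R n).[x]].

End weighted_shift.

(* Main.v *)
Require Import Defs.
From mathcomp Require Import all_boot all_order all_algebra.
From mathcomp Require Import all_classical all_reals all_analysis.
From mathcomp Require Import measurable_realfun complex ring lra zify.

(** A compact operator on l^2 cannot have diagonal entries <Be_k, e_k> that stay
    above a positive number as k grows, because the vectors e_k converge weakly
    to 0 ([compact_diag_lt]).  It therefore suffices to bound the diagonal of B
    from below, and the diagonal is a scalar matter.

    Write g_n for the n-th weight product.  Compressing the representation of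
    the powers of W to e_k gives
      g_(n+k) / g_k = 1 + b_k n + c_k n^2 + integral of Q_n d(mu_k),
    where b_k, c_k are the diagonal entries of B, C and mu_k is the measure
    <F(.)e_k, e_k> ([weighted_shift_diag_triplet]).  With n = 1 this reads
      g_k b_k = g_(k+1) - g_k - g_k c_k,
    so that two estimates are needed.

    - c_k is at most a constant divided by g_k.  Second differences in n turn
      the two representations of the same sequence into equality of moments of
      two measures: mu_k + 2 c_k delta_1 on one side and
      (x^k nu + 2 c delta_1) / g_k on the other.  Integrating against a
      nonnegative polynomial equal to 1 at the point 1, at most 1 on [0, 1] and
      as small as desired on the part of supp(nu) beyond the gap bounds 2 c_k g_k
      by 2c + nu([0, oo)) ([cpd_triplet_shift_quad_le]).

    - g_(k+1) - g_k is at least (theta - 1) g_k up to an error quadratic in k.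
      Indeed Q_(k+1) - Q_k = 1 + x + ... + x^(k-1), and (x - 1) Q_k is this sum
      minus k, whence the comparison for x >= theta; on [0, 1] the polynomial
      Q_k is at most k^2 ([Qpoly_growth]).  The gap means that nu charges no
      other points.

    Since nu charges [theta, oo), the sequence g grows at least like theta^k,
    which absorbs all quadratic errors, and b_k >= (theta - 1) / 2 for large k
    ([cpd_triplet_shift_lin_ge]). *)

Set Implicit Arguments.
Unset Strict Implicit.
Unset Printing Implicit Defensive.

Import Order.TTheory GRing.Theory Num.Theory.
Import numFieldNormedType.Exports.

Local Open Scope classical_set_scope.
Local Open Scope ring_scope.

(** * Supports of finite measures and integration of polynomials *)

Section support.
Context {R : realType}.
Implicit Types mu : {finite_measure set R -> \bar R}.

(** The real line has a countable base: the complement of the support is the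
    union of the null balls with rational centre and radius. *)
Lemma negligible_setC_support mu : mu.-negligible (~` measure_support mu).
Proof.
pose B (q : rat * rat) : set R := ball (ratr q.1 : R) (ratr q.2).
pose N n : set R :=
  if unpickle n is Some q then if mu (B q) == 0%E then B q else set0 else set0.
have mB q : measurable (B q) by exact: open_measurable (ball_open _ _).
apply: (negligibleS _ (@negligible_bigcup _ _ _ mu N _)) => [x /= | n].
  move=> /existsNP[U] /not_implyP[oU] /not_implyP[Ux /negP].
  rewrite -leNgt measure_le0 => /eqP U0.
  have [c [r [/set_mem xB BU]]] := open_subball_rat oU (mem_set Ux).
  exists (pickle (c, r)); first exact: I.
  rewrite /N pickleK.
  by rewrite (subset_measure0 (mB (c, r)) (open_measurable oU) BU U0) eqxx.
rewrite /N; case: (unpickle n) => [q|]; last exact: negligible_set0.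
by case: eqP => q0; [exact/negligibleP|exact: negligible_set0].
Qed.

Lemma compact_support_itv mu (K : set R) : compact K ->
  measure_support mu `<=` K -> exists2 L : R, 1 < L & mu `]L, +oo[%classic = 0%E.
Proof.
move=> + suppK; move=> /compact_bounded[M [_ /(_ (M + 1))]]; rewrite ltrDl ltr01 => /(_ isT) sM.
exists (Num.max 2 (M + 1)); first by rewrite lt_max ltr1n.
apply/negligibleP; first exact: measurable_itv.
apply: negligibleS (negligible_setC_support mu) => x /=.
rewrite in_itv/= andbT gt_max => /andP[_ Mx] /suppK /sM /(le_trans (ler_norm _)).
by rewrite leNgt Mx.
Qed.

End support.

Definition moment {R : realType} (mu : {finite_measure set R -> \bar R})
    (p : {poly R}) : R :=
  \int[mu]_(x in `[0%R, +oo[) p.[x].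

Section moment.
Context {R : realType}.
Variables (mu : {finite_measure set R -> \bar R}) (L : R).
Hypothesis mu_L : mu `]L, +oo[%classic = 0%E.

Lemma integrable_poly (p : {poly R}) :
  mu.-integrable `[0%R, +oo[%classic (EFin \o horner p).
Proof.
have mp A : measurable_fun A (horner p).
  apply: measurable_funTS; apply: continuous_measurable_fun.
  exact: continuous_horner.
apply/(negligible_integrable (N := `]L, +oo[%classic) _ _ _ mu_L) => //.
  exact/measurable_EFinP.
apply: measurable_bounded_integrable => //; first exact: measurableD.
  by rewrite -ge0_fin_numE// fin_num_measure//; exact: measurableD.
have : bounded_set (horner p @` `[0%R, L]).
  apply: compact_bounded; apply: continuous_compact; last exact: segment_compact.
  by apply: continuous_subspaceT; exact: continuous_horner.
move=> [M0 [M0r pM]]; exists M0; split=> // M /pM {}pM x [x0 xL].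
apply: pM; exists x => //.
move: x0 xL; rewrite /= !in_itv/= !andbT => -> /negP.
by rewrite -leNgt.
Qed.

Lemma momentD p q : moment mu (p + q) = moment mu p + moment mu q.
Proof.
rewrite /moment -RintegralD//; try exact: integrable_poly.
by apply: eq_Rintegral => x _; rewrite hornerD.
Qed.

Lemma momentZ a p : moment mu (a *: p) = a * moment mu p.
Proof.
rewrite /moment -RintegralZl//; last exact: integrable_poly.
by apply: eq_Rintegral => x _; rewrite hornerZ.
Qed.

Lemma moment0 : moment mu 0 = 0.
Proof. by rewrite -(scale0r 0) momentZ mul0r. Qed.

Lemma momentC a : moment mu a%:P = a * moment mu 1.
Proof. by rewrite -momentZ -[in RHS]polyC1 -mul_polyC -polyCM mulr1. Qed.

Lemma moment_ge0 p : (forall x, 0 <= x -> 0 <= p.[x]) -> 0 <= moment mu p.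
Proof. by move=> p0; apply: Rintegral_ge0 => x /=; rewrite in_itv/= andbT => /p0. Qed.

Lemma ae_le_moment (N : set R) p q : measurable N -> mu N = 0%E ->
  (forall x, 0 <= x -> x <= L -> ~ N x -> p.[x] <= q.[x]) ->
  moment mu p <= moment mu q.
Proof.
move=> mN N0 pq.
have mI : measurable (`]L, +oo[%classic : set R) by exact: measurable_itv.
have NL0 : mu (N `|` `]L, +oo[%classic) = 0%E by rewrite measureU0.
have mNL : measurable (N `|` `]L, +oo[%classic) by exact: measurableU.
rewrite /moment /Rintegral (negligible_integral mNL _ (integrable_poly p) NL0)//.
rewrite (negligible_integral mNL _ (integrable_poly q) NL0)//.
have mD : measurable (`[0%R, +oo[%classic `\` (N `|` `]L, +oo[%classic)) by exact: measurableD.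
have iD r : mu.-integrable (`[0%R, +oo[%classic `\` (N `|` `]L, +oo[%classic))
    (EFin \o horner r).
  by apply: integrableS (integrable_poly r) => //; exact: subDsetl.
apply: le_Rintegral => // x [/= + /not_orP[Nx]].
rewrite !in_itv/= !andbT => x0 /negP; rewrite -leNgt => xL.
exact: pq.
Qed.

Lemma ge_moment_itv (t r : R) p : 0 <= t ->
  (forall x, 0 <= x -> 0 <= p.[x]) -> (forall x, t <= x -> r <= p.[x]) ->
  r * fine (mu `[t, +oo[%classic) <= moment mu p.
Proof.
move=> t0 p0 rp.
have sub : `[t, +oo[%classic `<=` (`[0%R, +oo[%classic : set R).
  by move=> x /=; rewrite !in_itv/= !andbT; exact: le_trans.
have ip := integrable_poly p.
have ipt : mu.-integrable `[t, +oo[%classic (EFin \o horner p) by apply: integrableS sub ip.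
rewrite -(@Rintegral_cst _ _ _ mu `[t, +oo[%classic)//.
apply: (@le_trans _ _ (\int[mu]_(x in `[t, +oo[) p.[x])).
  apply: le_Rintegral => //.
    apply: measurable_bounded_integrable => //.
      by rewrite -ge0_fin_numE// fin_num_measure.
    exact: bounded_cst.
  by move=> x /=; rewrite in_itv/= andbT => /rp.
apply: fine_le; try exact: integrable_fin_num.
apply: ge0_subset_integral => //.
  exact: (integrableP _ _ _ ip).1.
by move=> x /=; rewrite in_itv/= andbT lee_fin => /p0.
Qed.

End moment.

(** * The polynomials Q_n *)

Section Qpoly.
Context {R : realType}.
Implicit Types (n k : nat) (x th : R).

Lemma geom_polyS n : \poly_(j < n.+1) 1 = \poly_(j < n) 1 + 'X^n :> {poly R}.
Proof.
apply/polyP => i; rewrite coefD !coef_poly coefXn ltnS leq_eqVlt.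
by case: eqVneq => [->|_]; rewrite ?ltnn ?add0r//= addr0.
Qed.

Lemma QpolyS n : Qpoly R n.+1 = Qpoly R n + \poly_(j < n) 1.
Proof.
apply/polyP => i; rewrite coefD !coef_poly /=.
case: (ltnP i n) => [ltin|lein].
  case: (ltnP i n.-1) => [lti|lei].
    by rewrite natr1; congr (_%:R); lia.
  by rewrite add0r (_ : (n.+1 - i - 1 = 1)%N)//; lia.
by rewrite ltnNge (leq_trans (leq_pred n) lein) addr0.
Qed.

Lemma Qpoly0 : Qpoly R 0 = 0.
Proof. by apply/polyP => i; rewrite coef_poly coef0. Qed.

(** This is what makes moments visible in a representation by the Q_n: the second
    difference at n of the integrals of Q_n is the n-th moment. *)
Lemma Qpoly_diff2 n : Qpoly R n.+2 + Qpoly R n = 2%:R *: Qpoly R n.+1 + 'X^n.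
Proof.
rewrite !QpolyS geom_polyS scaler_nat mulr2n; ring.
Qed.

Lemma Qpoly_ge0 n x : 0 <= x -> 0 <= (Qpoly R n).[x].
Proof.
by move=> x0; rewrite horner_poly sumr_ge0// => i _; rewrite mulr_ge0// exprn_ge0.
Qed.

(** The top monomial of Q_(n+2) is x^n, with coefficient 1. *)
Lemma Qpoly_ge_exp n x : 0 <= x -> x ^+ n <= (Qpoly R n.+2).[x].
Proof.
move=> x0; rewrite horner_poly/= big_ord_recr/=.
rewrite (_ : (n.+2 - n - 1 = 1)%N); last by lia.
rewrite mul1r lerDr sumr_ge0// => i _.
by rewrite mulr_ge0// exprn_ge0.
Qed.

Lemma Qpoly_le_sqr n x : 0 <= x -> x <= 1 -> (Qpoly R n).[x] <= n%:R ^+ 2.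
Proof.
move=> x0 x1; elim: n => [|n IH]; first by rewrite Qpoly0 horner0 expr0n.
rewrite QpolyS hornerD; apply: (@le_trans _ _ (n%:R ^+ 2 + n%:R)).
  rewrite lerD// horner_poly.
  apply: (@le_trans _ _ (\sum_(i < n) 1)); last by rewrite sumr_const card_ord.
  by apply: ler_sum => i _; rewrite mul1r exprn_ile1.
have := ler0n R n; rewrite -natr1; nra.
Qed.

Lemma Qpoly_mulXsub1 n : ('X - 1) * Qpoly R n = \poly_(j < n) 1 - n%:R%:P.
Proof.
have gE k : ('X - 1) * (\poly_(j < k) 1) = 'X^k - 1 :> {poly R}.
  rewrite poly_def subrX1; congr (_ * _).
  by apply: eq_bigr => i _; rewrite scale1r.
elim: n => [|n IH]; first by rewrite Qpoly0 poly_def big_ord0 mulr0 polyC0 subrr.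
rewrite QpolyS mulrDr IH gE geom_polyS -natr1 polyCD; ring.
Qed.

(** The right-hand side is the increment of Q at n, so this says that Q_n grows at
    rate theta - 1 off the gap.  Beyond theta it follows from
    [Qpoly_mulXsub1]; on [0, 1] the left-hand side is nonpositive, which is the
    purpose of the term n^2. *)
Lemma Qpoly_growth n th x : 1 <= th -> 0 <= x -> x <= 1 \/ th <= x ->
  (th - 1) * ((Qpoly R n).[x] - n%:R ^+ 2) <= (\poly_(j < n) (1 : R)).[x].
Proof.
move=> th1 x0 [x1|thx].
  apply: (@le_trans _ _ 0).
    by rewrite mulr_ge0_le0 ?subr_ge0// subr_le0 Qpoly_le_sqr.
  by rewrite horner_poly sumr_ge0// => i _; rewrite mul1r exprn_ge0.
have /(congr1 (fun p : {poly R} => p.[x])) := Qpoly_mulXsub1 n.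
rewrite hornerM !hornerD !hornerN hornerX !hornerC => /eqP.
rewrite eq_sym subr_eq => /eqP ->.
have := Qpoly_ge0 n x0; have := sqr_ge0 (n%:R : R); have := ler0n R n.
nra.
Qed.

(** Exponentials beat quadratics: with th^k = exp (k ln th), the cubic term of the
    exponential series is already enough. *)
Lemma sqr_le_geometric (th a d : R) : 1 < th -> 0 < d ->
  exists K, forall k, (K <= k)%N -> a * k%:R ^+ 2 <= d * th ^+ k.
Proof.
move=> th1 d0.
have l0 : 0 < ln th by rewrite ln_gt0.
pose e := d * ln th ^+ 3 / 6.
have e0 : 0 < e by rewrite divr_gt0// mulr_gt0// exprn_gt0.
exists (Num.bound (`|a| / e)) => k Kk.
have ak : `|a| <= e * k%:R.
  rewrite mulrC -ler_pdivrMr//; apply: le_trans (ltW (archi_boundP _)) _.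
    by rewrite divr_ge0// ltW.
  by rewrite ler_nat.
have thE : th ^+ k = expR (k%:R * ln th) by rewrite expRM_natl lnK// posrE; lra.
have /(expR_ge1Dxn 2) : 0 <= k%:R * ln th by rewrite mulr_ge0// ltW.
rewrite -thE exprMn (_ : 3`!%:R = 6%:R)// => ge.
have : a * k%:R ^+ 2 <= e * k%:R * k%:R ^+ 2.
  by rewrite ler_wpM2r ?sqr_ge0// (le_trans (ler_norm _)).
move/le_trans; apply.
have -> : e * k%:R * k%:R ^+ 2 = d * (k%:R ^+ 3 * ln th ^+ 3 / 6).
  by rewrite /e; field.
by rewrite ler_pM2l//; lra.
Qed.

End Qpoly.

(** * Scalar triplets and their shifts *)

Section triplet.
Context {R : realType}.
Implicit Types (g u : nat -> R) (mu nu : {finite_measure set R -> \bar R}).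

Definition cpd_triplet u (b c : R) mu := forall n,
  u n = 1 + b * n%:R + c * (n ^ 2)%:R + moment mu (Qpoly R n).

Lemma cpd_triplet_diff2 u (b c : R) mu (L : R) : mu `]L, +oo[%classic = 0%E ->
  cpd_triplet u b c mu ->
  forall n, u n.+2 + u n - 2 * u n.+1 = moment mu 'X^n + 2 * c.
Proof.
move=> muL uE n; rewrite !uE.
have /(congr1 (moment mu)) := Qpoly_diff2 (R := R) n.
rewrite !(momentD muL) (momentZ muL) => QE.
have -> : moment mu 'X^n = moment mu (Qpoly R n.+2) + moment mu (Qpoly R n)
    - 2 * moment mu (Qpoly R n.+1) by rewrite QE addrAC subrr add0r.
rewrite !natrX -!natr1; ring.
Qed.

(** When u is the sequence g shifted by k and normalized, its measure
    mu + 2 c' delta_1 and the measure (x^k nu + 2 c delta_1) / g k have the same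
    moments, hence the same integrals against polynomials; delta_1 accounts for
    the quadratic term, as n^2 has second difference 2. *)
Lemma cpd_triplet_shift_moment g (b c : R) nu (L : R) u (b' c' : R) mu (L' : R) k :
  nu `]L, +oo[%classic = 0%E -> mu `]L', +oo[%classic = 0%E ->
  cpd_triplet g b c nu -> cpd_triplet u b' c' mu ->
  (forall n, g (n + k)%N = g k * u n) ->
  forall p : {poly R}, moment nu (p * 'X^k) + 2 * c * p.[1] =
    g k * (moment mu p + 2 * c' * p.[1]).
Proof.
move=> nuL muL gE uE gu p.
have XnE n : moment nu ('X^n * 'X^k) + 2 * c = g k * (moment mu 'X^n + 2 * c').
  have := cpd_triplet_diff2 nuL gE (n + k).
  have := cpd_triplet_diff2 muL uE n.
  have -> : ((n + k).+2 = n.+2 + k)%N by lia.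
  have -> : ((n + k).+1 = n.+1 + k)%N by lia.
  rewrite !gu exprD => uX gX; rewrite -gX -uX; ring.
rewrite -[p]coefK poly_def.
elim/big_ind : _ => [|q r IHq IHr|i _].
- by rewrite mul0r !(moment0 nuL, moment0 muL) horner0 !mulr0 addr0 mulr0.
- rewrite mulrDl (momentD nuL) (momentD muL) hornerD.
  rewrite mulrDr addrACA IHq IHr; ring.
- rewrite -scalerAl (momentZ nuL) (momentZ muL) hornerZ hornerXn expr1n mulr1.
  have := XnE i; move: (moment _ _) (moment _ _) (p`_i) => x y a xy.
  by rewrite -[2 * c * a]mulrC -mulrDr xy; ring.
Qed.

(** The polynomial is an even power of 1 - ((x - 1) / L)^2, whose values on [0, L]
    lie in [0, 1] and decrease as x moves away from 1.  The power is even so that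
    the polynomial is nonnegative on the whole line: it also gets integrated
    against a measure whose support need not lie in [0, L]. *)
Lemma peak_poly (th L e : R) : 1 < th -> 1 < L -> 0 < e -> exists p : {poly R},
  [/\ p.[1] = 1, forall x, 0 <= p.[x], forall x, 0 <= x -> x <= L -> p.[x] <= 1 &
      forall x, th <= x -> x <= L -> p.[x] <= e].
Proof.
move=> th1 L1 e0.
pose s (x : R) := ((x - 1) / L) ^+ 2.
have s_ge0 x : 0 <= s x by exact: sqr_ge0.
have s_le1 x : 0 <= x -> x <= L -> s x <= 1.
  move=> x0 xL; rewrite /s -[leRHS](expr1n _ 2) -ler_sqrt ?exprn_gt0//.
  rewrite !sqrtr_sqr normr1 normrM normfV (gtr0_norm (_ : 0 < L)); last by lra.
  rewrite ler_pdivrMr; last by lra.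
  by rewrite mul1r ler_norml; apply/andP; split; lra.
have [m qm] : exists m, `|1 - s th| ^+ m <= e \/ L < th.
  have [thL|] := leP th L; last by move=> Lth; exists 0%N; right.
  have sth0 : 0 < s th by rewrite exprn_gt0// divr_gt0//; lra.
  have q1 : `| `|1 - s th| | < 1.
    have := s_le1 th; rewrite normr_id ltr_norml => sth1.
    by apply/andP; split; lra.
  have /cvgr0_norm_le/(_ _ e0)[m _ /(_ m)] := cvg_expr q1.
  move=> /(_ (leqnn m)) /= qm; exists m; left.
  by rewrite (le_trans (ler_norm _)).
exists ((1 - ((L^-1)%:P * ('X - 1)) ^+ 2) ^+ (m * 2)).
have pE x : ((1 - ((L^-1)%:P * ('X - 1)) ^+ 2) ^+ (m * 2)).[x] =
    `|1 - s x| ^+ m ^+ 2.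
  rewrite horner_exp !hornerE exprM -(real_normK (num_real _)) normrX /s.
  by rewrite [L^-1 * _]mulrC.
split => [|x|x x0 xL|x thx xL]; rewrite pE.
- by rewrite /s subrr mul0r expr0n subr0 normr1 !expr1n.
- exact: sqr_ge0.
- rewrite exprn_ile1 ?exprn_ge0// exprn_ile1// ger0_norm ?subr_ge0 ?s_le1//.
  by rewrite gerBl.
- case: qm => [qm|]; last by lra.
  have ss : `|1 - s x| <= `|1 - s th|.
    have s1 := s_le1 x; have s2 := s_le1 th.
    rewrite !ger0_norm ?subr_ge0; try by [apply: s1; lra|apply: s2; lra].
    rewrite lerB// /s !exprMn ler_wpM2r ?sqr_ge0//.
    by rewrite ler_pXn2r ?nnegrE//; lra.
  have q1 : `|1 - s x| ^+ m <= 1.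
    rewrite exprn_ile1// ger0_norm ?subr_ge0 ?gerBl//; apply: s_le1; lra.
  apply: (@le_trans _ _ (`|1 - s x| ^+ m)).
    by rewrite expr2 ler_piMl// exprn_ge0.
  by apply: le_trans qm; rewrite lerXn2r ?nnegrE.
Qed.

(** The mass 2 c' of mu + 2 c' delta_1 at 1 is at most the integral of a peak
    polynomial p, which [cpd_triplet_shift_moment] transfers to nu.  The peak is
    chosen below L^-k beyond the gap in order to compensate the factor x^k, so
    that p x^k <= 1 holds nu-almost everywhere. *)
Lemma cpd_triplet_shift_quad_le g (b c : R) nu (th L : R) u (b' c' : R) mu (L' : R) k :
  1 < th -> nu `]1, th[%classic = 0%E -> 1 < L ->
  nu `]L, +oo[%classic = 0%E -> mu `]L', +oo[%classic = 0%E ->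
  cpd_triplet g b c nu -> cpd_triplet u b' c' mu ->
  0 <= g k -> (forall n, g (n + k)%N = g k * u n) ->
  2 * (g k * c') <= 2 * c + moment nu 1.
Proof.
move=> th1 nu0 L1 nuL muL gE uE gk0 gu.
have Lk : 0 < L ^+ k by rewrite exprn_gt0//; lra.
have Lk' : 0 < (L ^+ k)^-1 by rewrite invr_gt0.
have [p [p1 p0 p_le1 p_le]] := peak_poly th1 L1 Lk'.
have := cpd_triplet_shift_moment nuL muL gE uE gu p; rewrite p1 !mulr1 => E.
have le_nu : moment nu (p * 'X^k) <= moment nu 1.
  apply: (ae_le_moment nuL _ nu0) => // x x0 xL xN.
  rewrite hornerM hornerXn hornerC.
  have [x1|x1] := leP x 1.
    by rewrite mulr_ile1 ?exprn_ge0 ?exprn_ile1// p_le1.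
  have thx : th <= x by rewrite leNgt; apply/negP => xth; apply: xN; rewrite /= in_itv/= x1.
  rewrite -(mulVf (lt0r_neq0 Lk)) ler_pM ?exprn_ge0 ?p_le//.
  by rewrite lerXn2r ?nnegrE//; lra.
have : 0 <= moment mu p by apply: moment_ge0.
move: E le_nu; move: (moment _ _) (moment _ _) (moment _ _) => x y z.
move: (g k) gk0 => G G0; nra.
Qed.

(** The threshold K is the point where the exponential growth of g, due to the
    mass of nu beyond the gap, overtakes the quadratic errors.  These involve g
    and its own triplet only, so K does not depend on the triplet of the shifted
    sequence. *)
Lemma cpd_triplet_shift_lin_ge g (b c : R) nu (th L : R) :
  1 < th -> nu `]1, th[%classic = 0%E -> 1 < L ->
  nu `]L, +oo[%classic = 0%E -> nu `[th, +oo[%classic != 0%E ->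
  0 <= c -> cpd_triplet g b c nu ->
  exists K, forall k u (b' c' : R) mu (L' : R), (K <= k)%N ->
    mu `]L', +oo[%classic = 0%E -> cpd_triplet u b' c' mu ->
    0 < g k -> (forall n, g (n + k)%N = g k * u n) ->
    (th - 1) / 2 <= b'.
Proof.
move=> th1 nu0 L1 nuL nuth c0 gE.
pose M := moment nu 1.
have M0 : 0 <= M by apply: moment_ge0 => x _; rewrite hornerC.
pose d := fine (nu `[th, +oo[%classic) / th ^+ 2.
have d0 : 0 < d.
  rewrite divr_gt0//; last by rewrite exprn_gt0//; lra.
  by rewrite fine_gt0// lt0e nuth measure_ge0/= -ge0_fin_numE// fin_num_measure.
(* The mass beyond the gap makes g grow exponentially. *)
have g_ge k : (2 <= k)%N -> 1 + b * k%:R + c * k%:R ^+ 2 + d * th ^+ k <= g k.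
  case: k => [|[|k]]// _; rewrite gE natrX lerD2l /d.
  rewrite (_ : _ * th ^+ k.+2 = th ^+ k * fine (nu `[th, +oo[%classic)); last first.
    by rewrite -(addn2 k) exprD [X in _ * X]mulrC mulrA divfK 1?mulrC// expf_neq0//; lra.
  apply: (ge_moment_itv nuL); first by lra.
    by move=> x; exact: Qpoly_ge0.
  move=> x thx; apply: le_trans (Qpoly_ge_exp _ _); last by lra.
  by rewrite lerXn2r ?nnegrE//; lra.
(* [Qpoly_growth], integrated. *)
have step k : b + c + (th - 1) * (g k - 1 - b * k%:R - (c + M) * k%:R ^+ 2)
    <= g k.+1 - g k.
  rewrite !gE QpolyS (momentD nuL).
  have : moment nu ((th - 1) *: (Qpoly R k - (k%:R ^+ 2)%:P)) <=
      moment nu (\poly_(j < k) 1).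
    apply: (ae_le_moment nuL _ nu0) => // x x0 xL xN.
    rewrite hornerZ hornerD hornerN hornerC.
    apply: Qpoly_growth; [lra|exact: x0|].
    have [x1|x1] := leP x 1; [by left|right].
    by rewrite leNgt; apply/negP => xth; apply: xN; rewrite /= in_itv/= x1.
  rewrite (momentZ nuL) -polyCN (momentD nuL) (momentC nuL) -/M !natrX -natr1.
  move: (moment _ _) (moment _ _) => x y.
  have := ler0n R k; move: (k%:R) => n n0.
  have := mulr_ge0 c0 n0.
  move=> cn xy; nra.
(* A k^2 bounds all the terms that g has to absorb; see AN below. *)
pose A := `|M / 2 - b| + (th - 1) * (1 + `|b| + c + M).
have [K KP] := sqr_le_geometric (2 / (th - 1) * A + `|b|) th1 d0.
exists (maxn K 2) => k u b' c' mu L' + muL uE gk0 gu.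
rewrite geq_max => /andP[/KP Kk k2].
have := cpd_triplet_shift_quad_le th1 nu0 L1 nuL muL gE uE (ltW gk0) gu.
rewrite -/M => c'_le.
have gk1 : g k.+1 = g k * (1 + b' + c').
  rewrite -add1n gu uE !mulr1 (_ : Qpoly R 1 = 0) ?(moment0 muL) ?addr0//.
  by rewrite QpolyS Qpoly0 poly_def big_ord0 addr0.
have n1 : 1 <= k%:R :> R by rewrite ler1n; lia.
have nn : k%:R <= k%:R ^+ 2 :> R by rewrite expr2 ler_peMl//; lra.
have N1 : 1 <= k%:R ^+ 2 :> R by lra.
have bN : `|b * k%:R| <= `|b| * k%:R ^+ 2.
  by rewrite normrM ler_wpM2l// ger0_norm.
have MbN : M / 2 - b <= `|M / 2 - b| * k%:R ^+ 2.
  by rewrite (le_trans (ler_norm _))// ler_peMr.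
have AN : M / 2 - b + (th - 1) * (1 + b * k%:R + (c + M) * k%:R ^+ 2)
    <= A * k%:R ^+ 2.
  rewrite [leRHS]mulrDl lerD// -mulrA ler_pM2l; last by lra.
  move: bN; rewrite ler_norml => /andP[_]; lra.
have gA : A * k%:R ^+ 2 <= (th - 1) / 2 * g k.
  have -> : A * k%:R ^+ 2 = (th - 1) / 2 * (2 / (th - 1) * A * k%:R ^+ 2).
    by field; lra.
  rewrite ler_pM2l; last by lra.
  have := g_ge k k2; move: bN Kk; rewrite ler_norml => /andP[+ _].
  rewrite mulrDl; have := mulr_ge0 c0 (sqr_ge0 (k%:R : R)); lra.
rewrite -(ler_pM2l gk0).
have := step k; rewrite gk1; lra.
Qed.

End triplet.

(** * Diagonals of operators on the sequence space *)

Section ell2.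
Context {R : realType}.
Implicit Types (f g : ell2 R) (T S : {linear ell2 R -> ell2 R}).

Lemma ReD (z w : R[i]) : complex.Re (z + w) = complex.Re z + complex.Re w.
Proof. by case: z w => [? ?] []. Qed.

Lemma csum_single (u : nat -> R[i]) k : (forall n, n != k -> u n = 0) ->
  csum u = u k.
Proof.
move=> u0.
have limE (p : R[i] -> R) : p 0 = 0 -> limn (series (p \o u)) = p (u k).
  move=> p0; apply/cvg_lim => //; apply: cvg_near_cst.
  exists k.+1 => // n /= kn.
  rewrite /series/= (bigD1_seq k) ?iota_uniq ?mem_index_iota//=.
  by rewrite big1 ?addr0// => i /u0 ->.
rewrite /csum (limE (@complex.Re R))// (limE (@complex.Im R))//.
by case: (u k).
Qed.

Lemma inner_unit f k : inner f (ell2_unit R k) = f k.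
Proof.
transitivity (csum (fun n => f n * ((n == k)%:R)^*)%C); first by [].
rewrite (@csum_single _ k) ?eqxx ?rmorph1 ?mulr1//.
by move=> n /negbTE ->; rewrite rmorph0 mulr0.
Qed.

Lemma norm_unit k : `|ell2_unit R k| = 1.
Proof.
apply/eqP; rewrite -(@pexpr_eq1 _ _ 2)//.
by rewrite -inner_normE inner_unit/= eqxx.
Qed.

(** The vectors T e_k have a cluster point y, so infinitely many of them are close
    to y in norm, hence in the k-th coordinate; and the coordinates of y tend
    to 0. *)
Lemma compact_diag_lt T (d : R) K : compact_operator T -> 0 < d ->
  exists2 k, (K <= k)%N & complex.Re (T (ell2_unit R k) k) < d.
Proof.
rewrite /compact_operator precompactE => cT d0.
have d2 : 0 < d / 2 by lra.
have [|y [_ yc]] := cT ((fun k => T (ell2_unit R k)) @ \oo) _ _.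
  exists 0%N => // k _; apply: subset_closure.
  by exists (ell2_unit R k) => //=; rewrite norm_unit.
(* The square-summable coordinates of y are eventually below d / 2. *)
have [N _ Ny] : \forall k \near \oo, Normc.normc (y k) ^+ 2 < (d / 2) ^+ 2.
  have := cvg_series_cvg_0 (@ell2P R y).
  move=> /cvgr_lt; apply; exact: exprn_gt0.
have F1 : ((fun k => T (ell2_unit R k)) @ \oo)
    [set T (ell2_unit R k) | k in [set k | (maxn N K <= k)%N]].
  by exists (maxn N K) => // k /= Hk; exists k.
have F2 : nbhs y (ball y (d / 2)%:C%C) by apply: nbhsx_ballx; rewrite ltcR.
have [_ [[k /= + <-]]] := yc _ _ F1 F2.
rewrite geq_max => /andP[Nk Kk]; rewrite -ball_normE/= distrC => yk.
exists k => //.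
have yk2 : Normc.normc (y k) < d / 2.
  by rewrite -(@ltr_pXn2r _ 2) ?nnegrE ?normc_ge0 ?ltW//; exact: Ny.
have Tyk : Normc.normc ((T (ell2_unit R k) - y) k) < d / 2.
  by rewrite -ltcR; apply: le_lt_trans yk; exact: ell2_coord_le.
have -> : T (ell2_unit R k) k = (T (ell2_unit R k) - y) k + y k.
  by rewrite -[in RHS]/(T (ell2_unit R k) k - y k + y k) subrK.
rewrite ReD.
have := normr_Re_le (y k); have := normr_Re_le ((T (ell2_unit R k) - y) k).
rewrite !ler_norml => /andP[_ ?] /andP[_ ?]; lra.
Qed.

Lemma weight_hat_cat (lam : nat -> R) n k :
  weight_hat lam (n + k) =
  weight_hat lam k * \prod_(i < n) lam (i + k)%N ^+ 2.
Proof.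
elim: n => [|n IH]; first by rewrite big_ord0 mulr1.
by rewrite big_ord_recr/= mulrA -IH /weight_hat addSn big_ord_recr.
Qed.

Lemma weighted_shift_iter (lam : nat -> R) W : is_weighted_shift lam W ->
  forall n k, iter n W (ell2_unit R k) =
    (\prod_(i < n) lam (i + k)%N)%:C%C *: ell2_unit R (n + k).
Proof.
move=> [_ We] n k; elim: n => [|n IH]; first by rewrite big_ord0 scale1r.
by rewrite iterS IH linearZ/= We scalerA -rmorphM/= big_ord_recr.
Qed.

Lemma adjoint_iter T S : adjoint T S -> forall n (x y : ell2 R),
  inner (iter n T x) y = inner x (iter n S y).
Proof.
move=> TS n x y; elim: n y => [//|n IH] y.
by rewrite iterS TS IH -iterSr.
Qed.

Lemma innerC f g : inner f g = ((inner g f)^*)%C.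
Proof. exact: ell2_innerC. Qed.

Lemma weighted_shift_power_diag (lam : nat -> R) W Wstar :
  is_weighted_shift lam W -> adjoint W Wstar -> forall n k,
  (iter n Wstar (iter n W (ell2_unit R k))) k =
  (\prod_(i < n) lam (i + k)%N ^+ 2)%:C%C.
Proof.
move=> Wsh adj n k; rewrite -inner_unit innerC -(adjoint_iter adj).
rewrite (weighted_shift_iter Wsh) -innerC inner_normE normrZ norm_unit mulr1.
by rewrite prodrXl rmorphXn /= real_normK// complex_real.
Qed.

Lemma support_form_measure (F : set R -> {linear ell2 R -> ell2 R}) h
    (mu : {finite_measure set R -> \bar R}) : form_measure F h mu ->
  measure_support mu `<=` semispectral_support F.
Proof.
move=> Fmu x xmu U oU /(xmu U oU) muU; exists h; apply/eqP => FU0.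
have := Fmu U (open_measurable oU); rewrite FU0 linear0l.
move=> /(congr1 (@complex.Re R))/=.
move=> /esym/eqP; rewrite fine_eq0 ?fin_num_measure//; last exact: open_measurable.
by rewrite gt_eqF.
Qed.

(** The sequence is the norm square of W^n e_k, that is, the weight products
    shifted by k and normalized. *)
Lemma weighted_shift_diag_triplet (lam : nat -> R) W B C F :
    is_weighted_shift lam W -> representing_triplet W B C F -> forall k : nat,
  exists (mu : {finite_measure set R -> \bar R}) (L : R), mu `]L, +oo[%classic = 0%E /\
    cpd_triplet (fun n => \prod_(i < n) lam (i + k)%N ^+ 2)
      (complex.Re (B (ell2_unit R k) k)) (complex.Re (C (ell2_unit R k) k)) mu.
Proof.
move=> Wsh [_ _ [[_ Fmeas _] cF] _ [Wstar [_ adj] WE]] k.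
have [mu Fmu] := Fmeas (ell2_unit R k).
have [L _ muL] := compact_support_itv cF (support_form_measure Fmu).
exists mu, L; split => // n.
have [I [_ IE] {}WE] := WE n.
have := weighted_shift_power_diag Wsh adj n k; rewrite WE.
have := IE _ _ Fmu; rewrite inner_unit => Ik.
rewrite -[LHS]/(ell2_unit R k k + n%:R * B (ell2_unit R k) k
  + (n ^ 2)%:R * C (ell2_unit R k) k + I (ell2_unit R k) k).
rewrite Ik /= eqxx => /(congr1 (@complex.Re R)); rewrite !ReD /= => <-.
have Remul m (z : R[i]) : complex.Re (m%:R * z) = complex.Re z * m%:R.
  by rewrite mulr_natl mulr_natr raddfMn.
by rewrite !Remul.
Qed.

End ell2.

Theorem proposition6p3 (R : realType) (lam : nat -> R)
    (lam_gt0 : forall n, 0 < lam n)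
    (lam_bounded : bounded_fun lam)
    (W : {linear ell2 R -> ell2 R})
    (W_shift : is_weighted_shift lam W)
    (W_cpd : cpd_operator W)
    (b c : R) (nu : {finite_measure set R -> \bar R})
    (scalar_triplet : scalar_representing_triplet lam b c nu)
    (B C : {linear ell2 R -> ell2 R}) (F : set R -> {linear ell2 R -> ell2 R})
    (triplet : representing_triplet W B C F)
    (sup_supp_gt1 : 1 < sup (measure_support nu))
    (theta : R)
    (theta_gt1 : 1 < theta)
    (theta_le : theta <= sup (measure_support nu))
    (nu_gap : nu `]1, theta[%classic = 0%E)
    (int_lt_oo : (\int[nu]_(x in `[0%R, 1%R[) ((x - 1) ^- 2)%:E < +oo)%E) :
  ~ compact_operator B.
Proof.
move=> cB.
have [c0 [_ cnu] _ gE] := scalar_triplet.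
have [L L1 nuL] := compact_support_itv cnu (@subset_refl _ _).
(* The support meets ]1, +oo[, and by the gap its mass lies beyond theta. *)
have nuth : nu `[theta, +oo[%classic != 0%E.
  have [x xnu x1] : exists2 x, measure_support nu x & 1 < x.
    apply: sup_gt => //; apply/set0P/eqP => nu0.
    by move: sup_supp_gt1; rewrite nu0 sup0 ltNge ler01.
  have : (0 < nu `]1%R, +oo[%classic)%E.
    by apply: xnu; [exact: interval_open|rewrite /= in_itv/= x1].
  apply: contraTneq => nuth; rewrite -leNgt measure_le0.
  rewrite (_ : `]1%R, +oo[%classic =
      `]1, theta[%classic `|` `[theta, +oo[%classic); last first.
    by rewrite -itv_bndbnd_setU// ?bnd_simp// ltW.
  by apply/eqP; apply: null_set_setU.
have [K KP] := cpd_triplet_shift_lin_ge theta_gt1 nu_gap L1 nuL nuth c0 gE.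
have th0 : 0 < (theta - 1) / 2 by lra.
have [k Kk] := compact_diag_lt K cB th0.
apply/negP; rewrite -leNgt.
have [mu [L' [muL uE]]] := weighted_shift_diag_triplet W_shift triplet k.
apply: (KP _ _ _ _ _ _ Kk muL uE) => [|n]; last exact: weight_hat_cat.
by apply: prodr_gt0 => i _; rewrite exprn_gt0.
Qed.
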